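(* Let $A=\varinjlim(A_i,\phi_i)$ be an AH algebra, where $A_i=\bigoplus_{t=1}^{k_i}M_{n_{it}}(C(X_{it}))$, the $X_{it}$ are connected compact Hausdorff spaces, and the $\phi_i\colon A_i\to A_{i+1}$ are diagonal $*$-homomorphisms. If $A$ has small eigenvalue variation (with respect to this inductive system), then $A$ has the LP property.
   Context: LP property: a $C^*$-algebra has the LP property if the linear span of its projections is norm dense in it. Diagonal maps: let $X,Y$ be compact Hausdorff spaces. A $*$-homomorphism $\phi\colon M_n(C(X))\to M_{nm+k}(C(Y))$ $(k\ge0)$ is diagonal if there are continuous maps $\lambda_1,\dots,\lambda_m\colon Y\to X$ with $\phi(f)=\mathrm{diag}(f\circ\lambda_1,\dots,f\circ\lambda_m,0)$ for all $f\in M_n(C(X))$, where $0$ is the zero matrix of order $k$. A $*$-homomorphism $\bigoplus_iM_{n_i}(C(X_i))\to\bigoplus_jM_{m_j}(C(Y_j))$ is diagonal if each partial map $M_{n_i}(C(X_i))\to M_{m_j}(C(Y_j))$ it induces is diagonal, where for maps between direct sums the blocks $f\circ\lambda_l$ and the zero entries of a partial map may be placed in any order along the diagonal (i.e. the form above holds up to conjugation by a permutation matrix), and a partial map may be zero ($m=0$). Eigenvalue variation: let $B=\bigoplus_{i=1}^kM_{n_i}(C(X_i))$ with each $X_i$ connected compact Hausdorff, and let $a\in B$ be self-adjoint. For $x\in X_i$ and $1\le m\le n_i$ let $\lambda_m(x)$ be the $m$-th lowest eigenvalue of $a(x)$ counted with multiplicity. Then $EV(a)$ is the maximum over all $i$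 and all $1\le m\le n_i$ of $\sup\{|\lambda_m(x)-\lambda_m(y)|:x,y\in X_i\}$. Small eigenvalue variation: $A=\varinjlim(A_i,\phi_i)$ has small eigenvalue variation if for every $i$, every self-adjoint $a\in A_i$ and every $\varepsilon>0$ there is $j\ge i$ with $EV(\phi_{ij}(a))<\varepsilon$, where $\phi_{ij}\colon A_i\to A_j$ is the composed connecting map. *)

(* Defs.v *)
From HB Require Import structures.
From mathcomp Require Import all_boot all_order all_fingroup all_algebra.
From mathcomp Require Import complex.
From mathcomp Require Import all_classical all_reals all_analysis.

Set Implicit Arguments.
Unset Strict Implicit.
Unset Printing Implicit Defensive.

Import Order.TTheory GRing.Theory Num.Theory numFieldNormedType.Exports.
Local Open Scope classical_set_scope.
Local Open Scope ring_scope.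

(* Algebras are not assumed to have a unit (a limit along non-unital
   connecting maps need not have one), so the multiplication cannot be that of
   a MathComp ring structure. *)
HB.mixin Record Lmodule_isStarAlgebra (K : numClosedFieldType) A
    of GRing.Lmodule K A := {
  smul : A -> A -> A;
  star : A -> A;
  smulA : associative smul;
  smulDl : left_distributive smul +%R;
  smulDr : right_distributive smul +%R;
  smulZl : forall (c : K) (x y : A), smul (c *: x) y = c *: smul x y;
  smulZr : forall (c : K) (x y : A), smul x (c *: y) = c *: smul x y;
  starK : involutive star;
  starD : {morph star : x y / x + y};
  starZ : forall (c : K) (x : A), star (c *: x) = c^* *: star x;
  starM : forall x y : A, star (smul x y) = smul (star y) (star x)
}.

#[short(type="starAlgType")]
HB.structure Definition StarAlgebra (K : numClosedFieldType) :=
  { A of GRing.Lmodule K A & Lmodule_isStarAlgebra K A }.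

(* As everywhere in MathComp-Analysis, the norm takes its values in the
   scalar field. *)
HB.mixin Record StarAlgebra_isCStarAlgebra (K : numClosedFieldType) A
    of StarAlgebra K A & CompleteNormedModule K A := {
  norm_smul_le : forall x y : A, `|smul x y| <= `|x| * `|y|;
  norm_star_smul : forall x : A, `|smul (star x) x| = `|x| ^+ 2
}.

#[short(type="cstarAlgType")]
HB.structure Definition CStarAlgebra (K : numClosedFieldType) :=
  { A of StarAlgebra K A & CompleteNormedModule K A
       & StarAlgebra_isCStarAlgebra K A }.

Definition star_hom (K : numClosedFieldType) (A B : starAlgType K)
    (f : A -> B) : Prop :=
  [/\ linear f, {morph f : x y / smul x y} & {morph f : x / star x}].

Definition self_adjoint (K : numClosedFieldType) (A : starAlgType K) (a : A) :=
  star a = a.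

Definition projection (K : numClosedFieldType) (A : starAlgType K) (p : A) :=
  star p = p /\ smul p p = p.

Definition linear_span (K : numClosedFieldType) (V : lmodType K) (S : set V) :
    set V :=
  [set v | exists (m : nat) (c : 'I_m -> K) (s : 'I_m -> V),
     (forall l, S (s l)) /\ v = \sum_(l < m) c l *: s l].

Definition LP_property (K : numClosedFieldType) (A : cstarAlgType K) : Prop :=
  dense (linear_span [set p : A | projection p] : set A).

Section MatrixValuedContinuity.
Variable K : numFieldType.

Lemma mx_continuousP (X : topologicalType) (m n : nat) (f : X -> 'M[K]_(m, n)) :
  continuous f <-> forall i j, continuous (fun x => f x i j).
Proof.
split=> [cf i j x|cf x A [P nP sPA]].
  exact: (continuous_comp (cf x) (@coord_continuous _ _ _ i j (f x))).
have : \forall y \near x, forall ij : 'I_m * 'I_n, P ij.1 ij.2 (f y ij.1 ij.2).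
  by apply: filter_forall => -[i j]; exact: cf (nP i j).
by apply: filterS => y Py; apply: sPA => i j; exact: Py (i, j).
Qed.

End MatrixValuedContinuity.

(* M_n(C(X)), as the *-algebra of continuous functions X -> M_n(K). *)
Definition mxC (K : numClosedFieldType) (X : topologicalType) (n : nat) : Type :=
  continuousType X 'M[K]_n.

Section MxC.
Variables (K : numClosedFieldType) (X : topologicalType) (n : nat).
Implicit Types f g h : mxC K X n.

HB.instance Definition _ := Choice.copy (mxC K X n) (continuousType X 'M[K]_n).

Lemma mxC_eqP f g : (forall x, f x = g x) -> f = g.
Proof. by move=> fg; apply/continuousEP. Qed.

Lemma mxC_entry f i j : continuous (fun x => f x i j).
Proof. by move: i j; apply/mx_continuousP; exact: cts_fun. Qed.

Lemma mxC_add_cts f g : continuous (fun x => f x + g x).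
Proof.
apply/mx_continuousP => i j.
rewrite (_ : (fun _ => _) = (fun x => f x i j + g x i j)); last first.
  by apply/funext => x; rewrite mxE.
by move=> x; apply: cvgD; exact: mxC_entry.
Qed.

Lemma mxC_scale_cts (c : K) f : continuous (fun x => c *: f x).
Proof.
apply/mx_continuousP => i j.
rewrite (_ : (fun _ => _) = (fun x => c * f x i j)); last first.
  by apply/funext => x; rewrite mxE.
by move=> x; apply: cvgMl_tmp; exact: mxC_entry.
Qed.

Lemma mxC_mul_cts f g : continuous (fun x => f x *m g x).
Proof.
apply/mx_continuousP => i j.
rewrite (_ : (fun _ => _) = (fun x => \sum_k f x i k * g x k j)); last first.
  by apply/funext => x; rewrite mxE.
apply: continuous_big => [|k _]; first exact: add_continuous.
by move=> x; apply: cvgM; exact: mxC_entry.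
Qed.

Lemma mxC_star_cts f : continuous (fun x => map_mx Num.conj (f x)^T).
Proof.
apply/mx_continuousP => i j.
rewrite (_ : (fun _ => _) = (fun x => (f x j i)^*)); last first.
  by apply/funext => x; rewrite !mxE.
move=> x; apply/cvgrPdist_lt => e e0.
have /cvgrPdist_lt /(_ e e0) := @mxC_entry f j i x.
by apply: filterS => y; rewrite -rmorphB norm_conjC.
Qed.

Lemma mxC_cst_cts (M : 'M[K]_n) : continuous (fun _ : X => M).
Proof. exact: cst_continuous. Qed.

Definition mxC_add f g : mxC K X n := mkcts (@mxC_add_cts f g).
Definition mxC_scale (c : K) f : mxC K X n := mkcts (@mxC_scale_cts c f).
Definition mxC_opp f : mxC K X n := mkcts (@mxC_scale_cts (-1) f).
Definition mxC_zero : mxC K X n := mkcts (@mxC_cst_cts 0).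
Definition mxC_mul f g : mxC K X n := mkcts (@mxC_mul_cts f g).
Definition mxC_star f : mxC K X n := mkcts (@mxC_star_cts f).

Program Definition mxC_zmodMixin := @GRing.isZmodule.Build (mxC K X n)
  mxC_zero mxC_opp mxC_add _ _ _ _.
Next Obligation. by move=> f g h; apply: mxC_eqP => x; exact: addrA. Qed.
Next Obligation. by move=> f g; apply: mxC_eqP => x; exact: addrC. Qed.
Next Obligation. by move=> f; apply: mxC_eqP => x; exact: add0r. Qed.
Next Obligation.
by move=> f; apply: mxC_eqP => x; rewrite /= /mkcts scaleN1r addNr.
Qed.
HB.instance Definition _ := mxC_zmodMixin.

Program Definition mxC_lmodMixin :=
  @GRing.Zmodule_isLmodule.Build K (mxC K X n) mxC_scale _ _ _ _.
Next Obligation. by move=> a b f; apply: mxC_eqP => x; exact: scalerA. Qed.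
Next Obligation. by move=> f; apply: mxC_eqP => x; exact: scale1r. Qed.
Next Obligation. by move=> a f g; apply: mxC_eqP => x; exact: scalerDr. Qed.
Next Obligation. by move=> f a b; apply: mxC_eqP => x; exact: scalerDl. Qed.
HB.instance Definition _ := mxC_lmodMixin.

Program Definition mxC_starMixin :=
  @Lmodule_isStarAlgebra.Build K (mxC K X n) mxC_mul mxC_star
    _ _ _ _ _ _ _ _ _.
Next Obligation. by move=> f g h; apply: mxC_eqP => x; exact: mulmxA. Qed.
Next Obligation. by move=> f g h; apply: mxC_eqP => x; exact: mulmxDl. Qed.
Next Obligation. by move=> f g h; apply: mxC_eqP => x; exact: mulmxDr. Qed.
Next Obligation. by move=> c f g; apply: mxC_eqP => x; exact/esym/scalemxAl. Qed.
Next Obligation. by move=> c f g; apply: mxC_eqP => x; exact/esym/scalemxAr. Qed.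
Next Obligation.
move=> f; apply: mxC_eqP => x; apply/matrixP => i j.
by rewrite /= /mkcts !mxE conjCK.
Qed.
Next Obligation.
move=> f g; apply: mxC_eqP => x; apply/matrixP => i j.
by rewrite /= /mkcts !mxE rmorphD.
Qed.
Next Obligation.
move=> c f; apply: mxC_eqP => x; apply/matrixP => i j.
by rewrite /= /mkcts !mxE rmorphM.
Qed.
Next Obligation.
move=> f g; apply: mxC_eqP => x.
by rewrite /= /mkcts /= /mkcts trmx_mul map_mxM.
Qed.
HB.instance Definition _ := mxC_starMixin.

End MxC.

Definition dsum (K : numClosedFieldType) (k : nat) (D : 'I_k -> starAlgType K) :
  Type := forall t, D t.

Section DirectSum.
Variables (K : numClosedFieldType) (k : nat) (D : 'I_k -> starAlgType K).

Lemma dsum_eqP (a b : dsum D) : (forall t, a t = b t) -> a = b.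
Proof. exact: functional_extensionality_dep. Qed.

HB.instance Definition _ := gen_eqMixin (dsum D).
HB.instance Definition _ := gen_choiceMixin (dsum D).

Program Definition dsum_zmodMixin := @GRing.isZmodule.Build (dsum D)
  (fun t => 0) (fun a t => - a t) (fun a b t => a t + b t) _ _ _ _.
Next Obligation. by move=> a b c; apply: dsum_eqP => t; exact: addrA. Qed.
Next Obligation. by move=> a b; apply: dsum_eqP => t; exact: addrC. Qed.
Next Obligation. by move=> a; apply: dsum_eqP => t; exact: add0r. Qed.
Next Obligation. by move=> a; apply: dsum_eqP => t; exact: addNr. Qed.
HB.instance Definition _ := dsum_zmodMixin.

Program Definition dsum_lmodMixin :=
  @GRing.Zmodule_isLmodule.Build K (dsum D) (fun c a t => c *: a t) _ _ _ _.
Next Obligation. by move=> a b f; apply: dsum_eqP => t; exact: scalerA. Qed.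
Next Obligation. by move=> f; apply: dsum_eqP => t; exact: scale1r. Qed.
Next Obligation. by move=> a f g; apply: dsum_eqP => t; exact: scalerDr. Qed.
Next Obligation. by move=> f a b; apply: dsum_eqP => t; exact: scalerDl. Qed.
HB.instance Definition _ := dsum_lmodMixin.

Program Definition dsum_starMixin :=
  @Lmodule_isStarAlgebra.Build K (dsum D)
    (fun a b t => smul (a t) (b t)) (fun a t => star (a t)) _ _ _ _ _ _ _ _ _.
Next Obligation. by move=> a b c; apply: dsum_eqP => t; exact: smulA. Qed.
Next Obligation. by move=> a b c; apply: dsum_eqP => t; exact: smulDl. Qed.
Next Obligation. by move=> a b c; apply: dsum_eqP => t; exact: smulDr. Qed.
Next Obligation. by move=> c a b; apply: dsum_eqP => t; exact: smulZl. Qed.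
Next Obligation. by move=> c a b; apply: dsum_eqP => t; exact: smulZr. Qed.
Next Obligation. by move=> a; apply: dsum_eqP => t; exact: starK. Qed.
Next Obligation. by move=> a b; apply: dsum_eqP => t; exact: starD. Qed.
Next Obligation. by move=> c a; apply: dsum_eqP => t; exact: starZ. Qed.
Next Obligation. by move=> a b; apply: dsum_eqP => t; exact: starM. Qed.
HB.instance Definition _ := dsum_starMixin.

Definition dsum_inj (s : 'I_k) (x : D s) : dsum D :=
  dfwith (0 : dsum D) s x.

End DirectSum.

Record blocks := Blocks {
  nblocks : nat;
  bsize : 'I_nblocks -> nat;
  bspace : 'I_nblocks -> topologicalType;
  nblocks_gt0 : (0 < nblocks)%N;
  bsize_gt0 : forall t, (0 < bsize t)%N;
  bspace_connected : forall t, connected [set: bspace t];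
  bspace_compact : forall t, compact [set: bspace t];
  bspace_hausdorff : forall t, hausdorff_space (bspace t)
}.

Definition block_alg (R : realType) (B : blocks) : starAlgType R[i] :=
  dsum (fun t : 'I_(nblocks B) => mxC R[i] (bspace t) (bsize t)).

Section Diagonal.
Variable K : numClosedFieldType.

(* The permutation matrix of s does not depend on y. The case m = 0 is the
   zero map. *)
Definition diagonal_map (X Y : topologicalType) (n N : nat)
    (phi : mxC K X n -> mxC K Y N) : Prop :=
  exists (m k : nat) (eN : (\sum_(l < m) n + k)%N = N)
         (lam : 'I_m -> continuousType Y X) (s : 'S_N),
    forall (f : mxC K X n) (y : Y),
      phi f y =
      perm_mx s
        *m castmx (eN, eN) (block_mx (\mxdiag_(l < m) f (lam l y)) 0 0 0)
        *m (perm_mx s)^T.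

End Diagonal.

Definition diagonal_hom (R : realType) (B B' : blocks)
    (phi : block_alg R B -> block_alg R B') : Prop :=
  forall (s : 'I_(nblocks B)) (t : 'I_(nblocks B')),
    diagonal_map
      (fun f : mxC R[i] (bspace s) (bsize s) => phi (dsum_inj f) t).

Section EigenvalueVariation.
Variable R : realType.

(* The characteristic polynomial is monic, so this lists its roots with
   multiplicity; they are real when M is Hermitian. *)
Definition eigenvalues (n : nat) (M : 'M[R[i]]_n) : seq R[i] :=
  sval (closed_field_poly_normal (char_poly M)).

(* Indices start at 0: lowest_eigenvalue M m is the (m+1)-st lowest one. *)
Definition lowest_eigenvalue (n : nat) (M : 'M[R[i]]_n) (m : nat) : R :=
  nth 0 (sort <=%R [seq complex.Re z | z <- eigenvalues M]) m.

Definition EV (B : blocks) (a : block_alg R B) : \bar R :=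
  \big[maxe/0%E]_(t < nblocks B) \big[maxe/0%E]_(m < bsize t)
    ereal_sup [set (`|lowest_eigenvalue (a t xy.1) m
                      - lowest_eigenvalue (a t xy.2) m|)%:E
              | xy in [set: bspace t * bspace t]].

End EigenvalueVariation.

Section InductiveLimit.
Variables (K : numClosedFieldType) (D : nat -> starAlgType K).
Variable phi : forall i, D i -> D i.+1.

Fixpoint connecting (i d : nat) : D i -> D (d + i)%N :=
  match d with
  | 0%N => id
  | d'.+1 => fun a => phi (connecting d' a)
  end.

Definition cocone (A : starAlgType K) (mu : forall i, D i -> A) : Prop :=
  (forall i, star_hom (mu i)) /\ (forall i a, mu i.+1 (phi a) = mu i a).

(* Universal property in the category of C*-algebras and *-homomorphisms. The
   norms of the D i play no role in it, as a *-homomorphism of C*-algebras is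
   automatically contractive. *)
Definition is_inductive_limit (A : cstarAlgType K) (mu : forall i, D i -> A) :
    Prop :=
  cocone mu /\
  forall (B : cstarAlgType K) (nu : forall i, D i -> B), cocone nu ->
    exists! psi : A -> B,
      star_hom psi /\ forall i a, psi (mu i a) = nu i a.

End InductiveLimit.

Definition small_eigenvalue_variation (R : realType) (B : nat -> blocks)
    (phi : forall i, block_alg R (B i) -> block_alg R (B i.+1)) : Prop :=
  forall i (a : block_alg R (B i)), self_adjoint a ->
  forall eps : R, 0 < eps ->
    exists d : nat, (EV (connecting phi d a) < eps%:E)%E.

(* Main.v *)
(* In M_n(C(Y)) with Y compact, every element of pointwise trace zero is a linear
   combination of projections: for real h, w with h^2 + w^2 = 1 the 2 x 2
   matrix [[1 + h, w], [w, 1 - h]] / 2 is a projection, and adding the one with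
   w or h negated isolates diag(h, - h) or the off-diagonal entries. Hence a
   self-adjoint b in A_j differs from its normalized trace tau(b), a central
   element, by such a combination. As the trace is the sum of the eigenvalues,
   tau(b) is within EV(b) of a constant on each X_t, and a constant is a
   multiple of a projection.

   No spectral theory is needed to bound the norm of the image of a central
   self-adjoint h with |h| <= 1: with s = sqrt(1 - h^2) the image of h + i s is
   unitary and h is its real part. The ranges of the A_i are dense in the limit
   by the uniqueness clause of the universal property, applied to the closure of
   their union as a C*-algebra in its own right. *)

From HB Require Import structures.
Require Import Defs.
From mathcomp Require Import all_boot all_order all_fingroup all_algebra.
From mathcomp Require Import complex.
From mathcomp Require Import all_classical all_reals all_analysis.
From mathcomp Require Import ring.

Set Implicit Arguments.
Unset Strict Implicit.
Unset Printing Implicit Defensive.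

Import Order.TTheory GRing.Theory Num.Theory numFieldNormedType.Exports.
Local Open Scope classical_set_scope.
Local Open Scope ring_scope.

(** * Norm estimates from the C*-identity *)

Section CStarNorm.
Variables (K : numClosedFieldType) (A : cstarAlgType K).
Implicit Types x y : A.

Lemma smulNl x y : smul (- x) y = - smul x y.
Proof. by rewrite -scaleN1r smulZl scaleN1r. Qed.

Lemma smulNr x y : smul x (- y) = - smul x y.
Proof. by rewrite -scaleN1r smulZr scaleN1r. Qed.

Lemma starN x : star (- x) = - star x.
Proof. by rewrite -scaleN1r starZ rmorphN rmorph1 scaleN1r. Qed.

(** The C*-identity and submultiplicativity bound the square of the norm of [y] by [|star y| * |y|];
    cancelling [|y|] gives one inequality, which applied to [star x] gives the other. *)
Lemma norm_star x : `|star x| = `|x|.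
Proof.
suff le y : `|y| <= `|star y|.
  by apply/eqP; rewrite eq_le le andbT -[leRHS]/(`|x|) -{2}(starK x) le.
have [->|y0] := eqVneq y 0; first by rewrite normr0.
by rewrite -(@ler_pM2r _ `|y|) ?normr_gt0// -expr2 -norm_star_smul norm_smul_le.
Qed.

Lemma norm_projection_le1 (e : A) : projection e -> `|e| <= 1.
Proof.
case=> se ee; have [->|e0] := eqVneq e 0; first by rewrite normr0 ler01.
rewrite -(@ler_pM2r _ `|e|) ?normr_gt0// mul1r -expr2 -norm_star_smul.
by rewrite se ee.
Qed.

(* The partial unitary x + 'i y has norm at most 1 and x is its real part. *)
Lemma norm_le1_of_sumsq (x y e : A) : projection e ->
  star x = x -> star y = y -> smul x y = smul y x ->
  smul x x + smul y y = e -> `|x| <= 1.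
Proof.
move=> pe sx sy xy xxyy; pose u := x + 'i *: y.
have su : star u = x - 'i *: y by rewrite /u starD starZ sx sy conjCi scaleNr.
have uu : smul (star u) u = e.
  rewrite su /u smulDl !smulDr smulNl smulZr smulNl !smulZl smulZr scalerA.
  by rewrite -expr2 sqrCi scaleN1r xy opprK -addrA addNKr.
have u1 : `|u| <= 1.
  rewrite -(@ler_pXn2r _ 2) ?nnegrE// expr1n -norm_star_smul uu.
  exact: norm_projection_le1.
have -> : x = 2^-1 *: (u + star u).
  rewrite su /u addrACA subrr addr0 -mulr2n -[x *+ 2]scaler_nat.
  by rewrite scalerA mulVf ?scale1r.
rewrite normrZ ger0_norm// mulrC ler_pdivrMr// mul1r.
rewrite (le_trans (ler_normD _ _))// norm_star.
by rewrite -[2]/(1 + 1) lerD.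
Qed.

End CStarNorm.

(** * Closure and density in terms of the norm *)

Section Closure.
Variables (K : numFieldType) (V : normedModType K).

Lemma closure_normP (S : set V) x :
  closure S x <-> forall e : K, 0 < e -> exists2 s, S s & `|x - s| < e.
Proof.
split=> [cx e e0|Sx U /nbhs_ballP[e e0 xeU]].
  by have [s [Ss]] := cx _ (nbhsx_ballx x e e0); rewrite -ball_normE; exists s.
have [s Ss xs] := Sx _ e0; exists s; split=> //; apply: xeU.
by rewrite -ball_normE.
Qed.

Lemma dense_normP (S : set V) :
  (forall x (e : K), 0 < e -> exists2 s, S s & `|x - s| < e) -> dense S.
Proof.
move=> Sd O [x Ox] oO.
have /closure_normP/(_ O) : forall e : K, 0 < e -> exists2 s, S s & `|x - s| < e.
  exact: Sd.
by rewrite setIC; apply; exact: open_nbhs_nbhs.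
Qed.

End Closure.

(** * Closed star-subalgebras as C*-algebras *)

Record closedStarSubalg (K : numClosedFieldType) (A : cstarAlgType K) := {
  csubset : set A;
  csub_closed : closed csubset;
  csub0 : csubset 0;
  csubD : forall x y, csubset x -> csubset y -> csubset (x + y);
  csubZ : forall c x, csubset x -> csubset (c *: x);
  csubM : forall x y, csubset x -> csubset y -> csubset (smul x y);
  csubS : forall x, csubset x -> csubset (star x)
}.

(** The universal property of the limit quantifies over C*-algebras as types, so a closed subalgebra
    becomes a type of its own before it can serve as a target. *)
Record csub_type (K : numClosedFieldType) (A : cstarAlgType K)
  (S : closedStarSubalg A) := CSub { csval : A; csvalP : csubset S csval }.

Section CSub.
Variables (K : numClosedFieldType) (A : cstarAlgType K).
Variable S : closedStarSubalg A.
Local Notation T := (csub_type S).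

Lemma csval_inj : injective (@csval K A S).
Proof.
move=> [x Sx] [y Sy] /= xy; case: y / xy Sy => Sy.
by congr CSub; exact: Prop_irrelevance.
Qed.

HB.instance Definition _ := gen_eqMixin T.
HB.instance Definition _ := gen_choiceMixin T.

(** It also provides the opposite, as scaling by [-1], so that closure under opposites need not be a
    field of the record. *)
Definition csub_scale c (x : T) : T := CSub (csubZ c (csvalP x)).

Program Definition csub_zmodMixin := @GRing.isZmodule.Build T
  (CSub (csub0 S)) (csub_scale (-1))
  (fun x y => CSub (csubD (csvalP x) (csvalP y))) _ _ _ _.
Next Obligation. by move=> x y z; apply: csval_inj; exact: addrA. Qed.
Next Obligation. by move=> x y; apply: csval_inj; exact: addrC. Qed.
Next Obligation. by move=> x; apply: csval_inj; exact: add0r. Qed.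
Next Obligation. by move=> x; apply: csval_inj; rewrite /= scaleN1r addNr. Qed.
HB.instance Definition _ := csub_zmodMixin.

Program Definition csub_lmodMixin :=
  @GRing.Zmodule_isLmodule.Build K T csub_scale _ _ _ _.
Next Obligation. by move=> a b x; apply: csval_inj; exact: scalerA. Qed.
Next Obligation. by move=> x; apply: csval_inj; exact: scale1r. Qed.
Next Obligation. by move=> a x y; apply: csval_inj; exact: scalerDr. Qed.
Next Obligation. by move=> x a b; apply: csval_inj; exact: scalerDl. Qed.
HB.instance Definition _ := csub_lmodMixin.

Program Definition csub_starMixin := @Lmodule_isStarAlgebra.Build K T
  (fun x y => CSub (csubM (csvalP x) (csvalP y)))
  (fun x => CSub (csubS (csvalP x))) _ _ _ _ _ _ _ _ _.
Next Obligation. by move=> x y z; apply: csval_inj; exact: smulA. Qed.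
Next Obligation. by move=> x y z; apply: csval_inj; exact: smulDl. Qed.
Next Obligation. by move=> x y z; apply: csval_inj; exact: smulDr. Qed.
Next Obligation. by move=> c x y; apply: csval_inj; exact: smulZl. Qed.
Next Obligation. by move=> c x y; apply: csval_inj; exact: smulZr. Qed.
Next Obligation. by move=> x; apply: csval_inj; exact: starK. Qed.
Next Obligation. by move=> x y; apply: csval_inj; exact: starD. Qed.
Next Obligation. by move=> c x; apply: csval_inj; exact: starZ. Qed.
Next Obligation. by move=> x y; apply: csval_inj; exact: starM. Qed.
HB.instance Definition _ := csub_starMixin.

Program Definition csub_normedMixin := @Lmodule_isNormed.Build K T
  (fun x => `|csval x|) _ _ _.
Next Obligation. by move=> x y; exact: ler_normD. Qed.
Next Obligation. by move=> c x; exact: normrZ. Qed.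
Next Obligation. by move=> x /normr0_eq0 x0; exact: csval_inj. Qed.
HB.instance Definition _ := csub_normedMixin.

Lemma csvalB (x y : T) : csval (x - y) = csval x - csval y.
Proof. by rewrite /= scaleN1r. Qed.

Lemma csub_normE (x : T) : `|x| = `|csval x|.
Proof. by []. Qed.

(** The image of [F] under [csval] is Cauchy in the complete space [A], and its limit stays in the
    closed set [csubset S]. *)
Lemma csub_complete (F : set_system T) : ProperFilter F -> cauchy F -> cvg F.
Proof.
move=> FF /cauchy_ballP Fc.
have /cauchy_cvg/cvg_ex[l Fl] : cauchy (@csval K A S @ F).
  apply/cauchy_ballP => e e0; have [[P Q] [/= FP FQ] PQ] := Fc e e0.
  exists (@csval K A S @` P, @csval K A S @` Q).
    by split=> /=; [apply: filterS FP|apply: filterS FQ] => x Px; exists x.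
  move=> [_ _] [/= [x Px <-] [y Qy <-]].
  by have := PQ (x, y) (conj Px Qy); rewrite /= -!ball_normE /= csub_normE csvalB.
have Sl : csubset S l.
  apply: (@closed_cvg _ _ F FF (@csval K A S) (csubset S)
    (@csub_closed _ _ S) _ l Fl).
  by apply: filterE => x; exact: csvalP.
apply/cvg_ex; exists (CSub Sl); apply/cvgrPdist_lt => e e0.
have /cvgrPdist_lt/(_ e e0) := Fl.
by apply: filterS => x; rewrite csub_normE csvalB.
Qed.
HB.instance Definition _ := Uniform_isComplete.Build T csub_complete.

Lemma csub_norm_smul_le (x y : T) : `|smul x y| <= `|x| * `|y|.
Proof. exact: norm_smul_le. Qed.

Lemma csub_norm_star_smul (x : T) : `|smul (star x) x| = `|x| ^+ 2.
Proof. exact: norm_star_smul. Qed.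

HB.instance Definition _ := StarAlgebra_isCStarAlgebra.Build K T
  csub_norm_smul_le csub_norm_star_smul.

End CSub.

(** * Elementary properties of star-homomorphisms *)

Section StarHom.
Variables (K : numClosedFieldType) (A B : starAlgType K) (f : A -> B).
Hypothesis f_hom : star_hom f.

Let f_linear : linear f. Proof. by case: f_hom. Qed.

Lemma star_homD x y : f (x + y) = f x + f y.
Proof. by have := f_linear 1 x y; rewrite !scale1r. Qed.

Lemma star_hom0 : f 0 = 0.
Proof. by apply: (addrI (f 0)); rewrite -star_homD !addr0. Qed.

Lemma star_homZ c x : f (c *: x) = c *: f x.
Proof. by have := f_linear c x 0; rewrite star_hom0 !addr0. Qed.

Lemma star_homM x y : f (smul x y) = smul (f x) (f y).
Proof. by case: f_hom. Qed.

Lemma star_homS x : f (star x) = star (f x).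
Proof. by case: f_hom. Qed.

Lemma star_hom_self_adjoint x : self_adjoint x -> self_adjoint (f x).
Proof. by rewrite /self_adjoint -star_homS => ->. Qed.

Lemma star_hom_projection p : projection p -> projection (f p).
Proof. by case=> sp pp; split; rewrite -?star_homS -?star_homM ?sp ?pp. Qed.

End StarHom.

Lemma star_hom_comp (K : numClosedFieldType) (A B C : starAlgType K)
    (g : B -> C) (f : A -> B) : star_hom g -> star_hom f -> star_hom (g \o f).
Proof.
move=> gh fh; split=> [c x y|x y|x] /=.
- by rewrite (star_homD fh) (star_homZ fh) (star_homD gh) (star_homZ gh).
- by rewrite (star_homM fh) (star_homM gh).
- by rewrite (star_homS fh) (star_homS gh).
Qed.

(** * Density of the images of the stages in the limit *)

Section InductiveLimitDense.
Variables (K : numClosedFieldType) (D : nat -> starAlgType K).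
Variables (phi : forall i, D i -> D i.+1) (A : cstarAlgType K).
Variable mu : forall i, D i -> A.
Arguments mu : clear implicits.

Lemma cocone_connecting : cocone phi mu ->
  forall i d a, mu (d + i)%N (connecting phi d a) = mu i a.
Proof. by case=> _ muphi i d a; elim: d => //= d <-; exact: muphi. Qed.

Definition limit_range : set A := [set x | exists i a, x = mu i a].

(** The connecting maps carry both preimages to the stage [maxn i j]. This is what makes the union
    of the ranges stable under sums and products. *)
Lemma limit_range_common x y : cocone phi mu ->
  limit_range x -> limit_range y ->
  exists i a b, x = mu i a /\ y = mu i b.
Proof.
move=> coc [i [a ->]] [j [b ->]].
have lift k (c : D k) l : (k <= l)%N -> exists c', mu k c = mu l c'.
  move=> /subnK <-; exists (connecting phi (l - k) c).
  by rewrite cocone_connecting.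
have [a' ->] := lift i a (maxn i j) (leq_maxl _ _).
have [b' ->] := lift j b (maxn i j) (leq_maxr _ _).
by exists (maxn i j), a', b'.
Qed.

Hypothesis coc : cocone phi mu.

Let mu_hom i : star_hom (mu i). Proof. by case: coc. Qed.

Let E := closure limit_range.

Let limit_closure0 : E 0.
Proof.
by apply: subset_closure; exists 0%N, 0; rewrite (star_hom0 (mu_hom 0)).
Qed.

Let limit_closureD x y : E x -> E y -> E (x + y).
Proof.
move=> /closure_normP xE /closure_normP yE; apply/closure_normP => e e0.
have e20 : 0 < e / 2 by rewrite divr_gt0.
have [x' Sx' xx'] := xE _ e20; have [y' Sy' yy'] := yE _ e20.
have [i [a [b [ex ey]]]] := limit_range_common coc Sx' Sy'.
exists (x' + y').
  by exists i, (a + b); rewrite (star_homD (mu_hom i)) ex ey.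
by rewrite opprD addrACA (splitr e) (le_lt_trans (ler_normD _ _))// ltrD.
Qed.

Let limit_closureZ c x : E x -> E (c *: x).
Proof.
move=> /closure_normP xE; apply/closure_normP => e e0.
have c0 : 0 < `|c| + 1 by rewrite ltr_wpDl.
have [_ [i [a ->]] xa] := xE _ (divr_gt0 e0 c0).
exists (c *: mu i a); first by exists i, (c *: a); rewrite (star_homZ (mu_hom i)).
rewrite -scalerBr normrZ; move: xa; rewrite ltr_pdivlMr// => /le_lt_trans; apply.
by rewrite mulrC ler_wpM2l// lerDl.
Qed.

Let limit_closureS x : E x -> E (star x).
Proof.
move=> /closure_normP xE; apply/closure_normP => e e0.
have [_ [i [a ->]] xa] := xE _ e0.
exists (star (mu i a)).
  by exists i, (star a); rewrite (star_homS (mu_hom i)).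
by rewrite -starN -starD norm_star.
Qed.

Let limit_closureM x y : E x -> E y -> E (smul x y).
Proof.
move=> /closure_normP xE /closure_normP yE; apply/closure_normP => e e0.
have y0 : 0 < `|y| + 1 by rewrite ltr_wpDl.
have e20 : 0 < e / 2 by rewrite divr_gt0.
have [x' Sx' xx'] := xE _ (divr_gt0 e20 y0).
(* [y'] is chosen after [x'], since its tolerance involves the norm of [x']; the added [1] keeps the
   denominator positive. *)
have x0 : 0 < `|x'| + 1 by rewrite ltr_wpDl.
have [y' Sy' yy'] := yE _ (divr_gt0 e20 x0).
have [i [a [b [ex ey]]]] := limit_range_common coc Sx' Sy'.
exists (smul x' y').
  by exists i, (smul a b); rewrite (star_homM (mu_hom i)) ex ey.
have -> : smul x y - smul x' y' = smul (x - x') y + smul x' (y - y').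
  by rewrite smulDl smulDr smulNl smulNr addrA subrK.
rewrite (le_lt_trans (ler_normD _ _))// (splitr e) ltrD//.
  rewrite (le_lt_trans (norm_smul_le _ _))//.
  move: xx'; rewrite ltr_pdivlMr// => /le_lt_trans; apply.
  by rewrite ler_wpM2l// lerDl.
rewrite (le_lt_trans (norm_smul_le _ _))//.
move: yy'; rewrite ltr_pdivlMr// => /le_lt_trans; apply.
by rewrite mulrC ler_wpM2l// lerDl.
Qed.

Definition limit_subalg : closedStarSubalg A := {|
  csub_closed := @closed_closure A limit_range;
  csub0 := limit_closure0;
  csubD := limit_closureD;
  csubZ := limit_closureZ;
  csubM := limit_closureM;
  csubS := limit_closureS |}.

End InductiveLimitDense.

(* A factors through the closed subalgebra generated by the ranges, and by
   uniqueness the resulting endomorphism of A is the identity. *)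
Lemma inductive_limit_dense (K : numClosedFieldType) (D : nat -> starAlgType K)
    (phi : forall i, D i -> D i.+1) (A : cstarAlgType K)
    (mu : forall i, D i -> A) :
  is_inductive_limit phi mu -> forall x, closure (limit_range mu) x.
Proof.
case=> coc univ x; pose S := limit_subalg coc.
have muS i a : csubset S (mu i a) by apply: subset_closure; exists i, a.
have [mu_hom mu_phi] := coc.
have nu_coc : cocone phi (fun i a => CSub (muS i a) : csub_type S).
  split=> [i|i a]; last by apply: csval_inj; exact: mu_phi.
  split=> [c a b|a b|a]; apply: csval_inj => /=.
  - by rewrite (star_homD (mu_hom i)) (star_homZ (mu_hom i)).
  - exact: star_homM.
  - exact: star_homS.
have [psi [[psi_hom psi_mu] _]] := univ _ _ nu_coc.
have [id0 [_ uniq_id]] := univ A mu coc.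
have idE := uniq_id idfun; have jE := uniq_id (@csval K A S \o psi).
suff <- : csval (psi x) = x by exact: (csvalP (psi x)).
have -> : csval (psi x) = idfun x => //.
rewrite -[LHS]/((@csval K A S \o psi) x) -jE ?idE//.
by split=> [|i a /=]; [exact: star_hom_comp | rewrite psi_mu].
Qed.

(** * Linear spans and the span of the projections *)

Section LinearSpan.
Variables (K : numClosedFieldType) (V : lmodType K) (S : set V).

Lemma linear_span_sub x : S x -> linear_span S x.
Proof.
by move=> Sx; exists 1%N, (fun=> 1), (fun=> x); rewrite big_ord1 scale1r.
Qed.

Lemma linear_span0 : linear_span S 0.
Proof.
exists 0%N, (fun i => match i with Ordinal _ h => 0 end), (fun=> 0).
by split=> [[]|]//; rewrite big_ord0.
Qed.

Lemma linear_spanD x y :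
  linear_span S x -> linear_span S y -> linear_span S (x + y).
Proof.
move=> [m [c [s [Ss ->]]]] [n [d [t [St ->]]]].
pose pick T (f : 'I_m -> T) (g : 'I_n -> T) k :=
  match fintype.split k with inl i => f i | inr j => g j end.
exists (m + n)%N, (pick _ c d), (pick _ s t); split.
  by move=> k; rewrite /pick; case: fintype.splitP.
rewrite big_split_ord /=; congr (_ + _); apply: eq_bigr => k _; rewrite /pick.
  by rewrite -[lshift n k]/(unsplit (inl k)) unsplitK.
by rewrite -[rshift m k]/(unsplit (inr k)) unsplitK.
Qed.

Lemma linear_spanZ a x : linear_span S x -> linear_span S (a *: x).
Proof.
move=> [m [c [s [Ss ->]]]]; exists m, (fun l => a * c l), s; split=> //.
by rewrite scaler_sumr; apply: eq_bigr => l _; rewrite scalerA.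
Qed.

Lemma linear_spanB x y :
  linear_span S x -> linear_span S y -> linear_span S (x - y).
Proof. by move=> Sx Sy; rewrite -scaleN1r; apply/linear_spanD/linear_spanZ. Qed.

Lemma linear_span_sum I (r : seq I) (P : pred I) (F : I -> V) :
  (forall i, P i -> linear_span S (F i)) ->
  linear_span S (\sum_(i <- r | P i) F i).
Proof.
move=> SF; elim/big_ind: _ => //; first exact: linear_span0.
exact: linear_spanD.
Qed.

End LinearSpan.

Definition projection_span (K : numClosedFieldType) (A : starAlgType K) : set A :=
  linear_span [set p : A | projection p].

Lemma star_hom_projection_span (K : numClosedFieldType) (A B : starAlgType K)
    (f : A -> B) x :
  star_hom f -> projection_span x -> projection_span (f x).
Proof.
move=> fh [m [c [s [Ss ->]]]].
have -> : f (\sum_(l < m) c l *: s l) = \sum_(l < m) c l *: f (s l).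
  rewrite (big_morph f (star_homD fh) (star_hom0 fh)).
  by apply: eq_bigr => l _; rewrite star_homZ.
apply: linear_span_sum => l _; apply: linear_spanZ; apply: linear_span_sub.
exact/star_hom_projection/Ss.
Qed.

(** * Continuous scalar functions *)

Section ContinuousScalars.
Variables (K : numClosedFieldType) (X : topologicalType).
Implicit Types h : X -> K.

Lemma conj_continuous h : continuous h -> continuous (fun x => (h x)^*).
Proof.
move=> ch x; apply/cvgrPdist_lt => e e0.
have /cvgrPdist_lt/(_ e e0) := ch x.
by apply: filterS => y; rewrite -rmorphB norm_conjC.
Qed.

(** Factor [a - b] as a difference of squares and use that the difference of the roots is at most
    their sum. Continuity of [sqrtC] on nonnegative functions follows. *)
Lemma sqrtC_dist (a b : K) : 0 <= a -> 0 <= b ->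
  `|sqrtC a - sqrtC b| ^+ 2 <= `|a - b|.
Proof.
move=> a0 b0; rewrite -{2}(sqrtCK a) -{2}(sqrtCK b) subr_sqr normrM expr2.
rewrite ler_wpM2l// (le_trans (ler_normB _ _))//.
by rewrite !ger0_norm// ?addr_ge0// sqrtC_ge0.
Qed.

Lemma sqrtC_continuous h : continuous h -> (forall x, 0 <= h x) ->
  continuous (fun x => sqrtC (h x)).
Proof.
move=> ch h0 x; apply/cvgrPdist_lt => e e0.
have /cvgrPdist_lt/(_ _ (exprn_gt0 2 e0)) := ch x.
apply: filterS => y hxy.
rewrite -(@ltr_pXn2r _ 2) ?nnegrE// ?ltW//.
by rewrite (le_lt_trans _ hxy)// sqrtC_dist.
Qed.

Lemma Re_continuous h : continuous h -> continuous (fun x => 'Re (h x)).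
Proof.
move=> ch; rewrite (_ : (fun _ => _) = fun x => (h x + (h x)^*) / 2); last first.
  by apply/funext => x; rewrite ReE.
by move=> x; apply: cvgMr_tmp; apply: cvgD; [exact: ch|exact: conj_continuous].
Qed.

Lemma Im_continuous h : continuous h -> continuous (fun x => 'Im (h x)).
Proof.
move=> ch; rewrite (_ : (fun _ => _) = fun x => - 'Re ('i * h x)); last first.
  by apply/funext => x; rewrite ReMil opprK.
move=> x; apply: cvgN; move: x; apply: Re_continuous => x.
by apply: cvgMl_tmp; exact: ch.
Qed.

(** Any [C] above [|h x| + 1] bounds [h] on a neighbourhood of [x]; the near-covering form of
    compactness turns these local bounds into one valid everywhere for all large [C]. *)
Lemma compact_continuous_bounded h : compact [set: X] -> continuous h ->
  exists2 C : K, 0 < C & forall x, `|h x| <= C.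
Proof.
move=> /compact_near_coveringP Xc ch.
have hC : \forall C \near +oo_K, [set: X] `<=` (fun x => `|h x| <= C).
  apply: (Xc K +oo_K (fun C x => `|h x| <= C)) => x _.
  exists ([set y | `|h x - h y| < 1], [set C | `|h x| + 1 < C]).
    split => /=; first by have /cvgrPdist_lt/(_ 1 ltr01) := ch x.
    by apply: nbhs_pinfty_gt; rewrite realD.
  move=> [y C] [/= hxy hC]; rewrite (le_trans _ (ltW hC))//.
  rewrite -[h y](subrK (h x)) (le_trans (ler_normD _ _))// addrC lerD2l.
  by rewrite distrC ltW.
have [C [C0 hC']] : exists C : K, 0 < C /\ forall x, `|h x| <= C.
  near +oo_K => C; exists C; split; first by near: C; exact: nbhs_pinfty_gt.
  by move=> x; move: x; near: C; apply: filterS hC => C hC x; exact: hC.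
by exists C.
Unshelve. all: by end_near.
Qed.

End ContinuousScalars.

(** * Rank-one projections in a two-dimensional corner *)

Section RankOneProjection.
Variables (K : numClosedFieldType) (n : nat) (i j : 'I_n).
Local Notation E := delta_mx.

(* The 2 x 2 block [[1 + h, w], [w^*, 1 - h]] / 2 in rows and columns i, j. *)
Definition bloch_mx (h w : K) : 'M[K]_n :=
  2^-1 *: ((1 + h) *: E i i + (1 - h) *: E j j + w *: E i j + w^* *: E j i).

Lemma bloch_mx_star (h w : K) : h \is Num.real ->
  map_mx Num.conj (bloch_mx h w)^T = bloch_mx h w.
Proof.
move=> /CrealP hr; apply/matrixP => a b; rewrite !mxE.
rewrite !(rmorphM, rmorphD, rmorphN, fmorphV, rmorph_nat, rmorph1) /= conjCK hr.
by rewrite ![_ && (a == _)]andbC [X in _ * X]addrAC.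
Qed.

Lemma bloch_mx_idem (h w : K) : i != j -> h ^+ 2 + w * w^* = 1 ->
  bloch_mx h w *m bloch_mx h w = bloch_mx h w.
Proof.
move=> ij hw; have ji : j != i by rewrite eq_sym.
rewrite /bloch_mx -scalemxAl -scalemxAr scalerA.
rewrite !(mulmxDl, mulmxDr) -!scalemxAl -!scalemxAr !scalerA.
rewrite !(mul_delta_mx, mul_delta_mx_0 _ _ _ ij, mul_delta_mx_0 _ _ _ ji).
rewrite !scaler0 !(addr0, add0r).
apply/matrixP => a b; rewrite !mxE.
move: (_ && _)%:R (_ && _)%:R (_ && _)%:R (_ && _)%:R => eji ejj eij eii.
(* The identity is polynomial and uses [w^*] only through [hw], so the conjugate becomes a free
   variable [v]; the difference of both sides is then a multiple of [h ^+ 2 + w * v - 1]. *)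
move: hw; move: (w^*) => v hw.
apply/eqP; rewrite -subr_eq0; apply/eqP.
rewrite [LHS](_ : _ = 4^-1 * (h ^+ 2 + w * v - 1) * (eii + ejj)); last by field.
by rewrite hw subrr mulr0 mul0r.
Qed.

End RankOneProjection.

(** * Elements of pointwise trace zero are in the span of the projections *)

Section TraceZero.
Variables (K : numClosedFieldType) (X : topologicalType) (n : nat).
Hypothesis X_compact : compact [set: X].
Local Notation E := delta_mx.

Lemma scalar_mx_continuous (h : X -> K) (M : 'M[K]_n) : continuous h ->
  continuous (fun x => h x *: M).
Proof.
move=> ch; apply/mx_continuousP => a b.
rewrite (_ : (fun _ => _) = (fun x => h x * M a b)); last first.
  by apply/funext => x; rewrite mxE.
by move=> x; apply: cvgMr_tmp; exact: ch.
Qed.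

Definition mxC_scalar (h : X -> K) (ch : continuous h) (M : 'M[K]_n) :
  mxC K X n := mkcts (@scalar_mx_continuous h M ch).

Lemma bloch_mx_continuous (i j : 'I_n) (h w : X -> K) :
  continuous h -> continuous w ->
  continuous (fun x => bloch_mx i j (h x) (w x)).
Proof.
move=> ch cw.
have c1 : continuous (fun x => 1 + h x).
  by move=> x; apply: cvgD; [exact: cvg_cst|exact: ch].
have c2 : continuous (fun x => 1 - h x).
  by move=> x; apply: cvgB; [exact: cvg_cst|exact: ch].
pose p := 2^-1 *: (mxC_scalar c1 (E i i) + mxC_scalar c2 (E j j)
   + mxC_scalar cw (E i j) + mxC_scalar (conj_continuous cw) (E j i)).
exact: (@cts_fun _ _ p).
Qed.

Definition mxC_bloch (i j : 'I_n) (h w : X -> K) (ch : continuous h)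
  (cw : continuous w) : mxC K X n := mkcts (@bloch_mx_continuous i j h w ch cw).

Lemma bloch_span (i j : 'I_n) (h w : X -> K) (ch : continuous h)
    (cw : continuous w) : i != j -> (forall x, h x \is Num.real) ->
  (forall x, h x ^+ 2 + w x * (w x)^* = 1) ->
  projection_span (mxC_bloch i j ch cw).
Proof.
move=> ij hr hw; apply: linear_span_sub; split; apply: mxC_eqP => x.
  exact: bloch_mx_star.
exact: bloch_mx_idem.
Qed.

(** [E i i] and [E j j] are the Bloch projections with [w = 0] and [h = 1] or [h = -1]. *)
Lemma delta_span (i j : 'I_n) (f : mxC K X n) : i != j ->
  (forall x, f x = E i i + E j j) -> projection_span f.
Proof.
move=> ij fE.
have c1 : continuous (fun _ : X => 1 : K) by move=> x; exact: cvg_cst.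
have c0 : continuous (fun _ : X => 0 : K) by move=> x; exact: cvg_cst.
have cN1 : continuous (fun _ : X => -1 : K) by move=> x; exact: cvg_cst.
have -> : f = mxC_bloch i j c1 c0
            + mxC_bloch i j cN1 c0.
  apply: mxC_eqP => x; rewrite fE; apply/matrixP => a b.
  by rewrite /= /mkcts !mxE rmorph0; field.
apply: linear_spanD; apply: bloch_span => // x; rewrite ?realN ?real1//.
  by rewrite mul0r addr0 expr1n.
by rewrite mul0r addr0 sqrrN expr1n.
Qed.

(** Adding the projections for [w] and [- w] cancels the off-diagonal entries; subtracting
    [E i i + E j j] leaves [f]. *)
Lemma bloch_diag_span (i j : 'I_n) (h w : X -> K) (f : mxC K X n) :
  i != j -> continuous h -> continuous w -> (forall x, h x \is Num.real) ->
  (forall x, h x ^+ 2 + w x * (w x)^* = 1) ->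
  (forall x, f x = h x *: (E i i - E j j)) -> projection_span f.
Proof.
move=> ij ch cw hr hw fE.
have cNw : continuous (fun x => - w x) by move=> x; apply: cvgN; exact: cw.
have cst1 : continuous (fun _ : X => (E i i + E j j : 'M[K]_n)).
  by move=> x; exact: cvg_cst.
rewrite (_ : f = mxC_bloch i j ch cw
               + mxC_bloch i j ch cNw
               - (mkcts cst1 : mxC K X n)); last first.
  apply: mxC_eqP => x; rewrite fE; apply/matrixP => a b.
  by rewrite /= /mkcts !mxE rmorphN; field.
apply: linear_spanB; last exact: delta_span ij _.
apply: linear_spanD; apply: bloch_span => // x.
by rewrite rmorphN mulrNN.
Qed.

(** Here the sign of [h] is flipped instead, which cancels [h] on the diagonal. *)
Lemma bloch_offdiag_span (i j : 'I_n) (h w : X -> K) (f : mxC K X n) :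
  i != j -> continuous h -> continuous w -> (forall x, h x \is Num.real) ->
  (forall x, h x ^+ 2 + w x * (w x)^* = 1) ->
  (forall x, f x = w x *: E i j + (w x)^* *: E j i) -> projection_span f.
Proof.
move=> ij ch cw hr hw fE.
have cNh : continuous (fun x => - h x) by move=> x; apply: cvgN; exact: ch.
have cst1 : continuous (fun _ : X => (E i i + E j j : 'M[K]_n)).
  by move=> x; exact: cvg_cst.
rewrite (_ : f = mxC_bloch i j ch cw
               + mxC_bloch i j cNh cw
               - (mkcts cst1 : mxC K X n)); last first.
  apply: mxC_eqP => x; rewrite fE; apply/matrixP => a b.
  by rewrite /= /mkcts !mxE; field.
apply: linear_spanB; last exact: delta_span ij _.
apply: linear_spanD; apply: bloch_span => // x; first by rewrite realN.
by rewrite sqrrN.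
Qed.

(** Completes a real contraction to a point of the unit circle: first for the entries of Bloch
    projections, later for the partial unitary behind the norm bound. *)
Lemma cosine_complement (u : X -> K) : continuous u ->
  (forall x, u x \is Num.real) -> (forall x, `|u x| <= 1) ->
  exists s : X -> K, [/\ continuous s, forall x, s x \is Num.real &
    forall x, u x ^+ 2 + s x ^+ 2 = 1].
Proof.
move=> cu ur u1.
have u2 x : 0 <= 1 - u x ^+ 2.
  by rewrite subr_ge0 -(real_normK (ur x)) expr_le1.
exists (fun x => sqrtC (1 - u x ^+ 2)); split=> [|x|x].
- apply: sqrtC_continuous => // x; apply: cvgB; first exact: cvg_cst.
  by rewrite expr2; apply: cvgM; exact: cu.
- by rewrite ger0_real// sqrtC_ge0.
- by rewrite sqrtCK addrCA subrr addr0.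
Qed.

Lemma real_diag_span (i j : 'I_n) (u : X -> K) (cu : continuous u) : i != j ->
  (forall x, u x \is Num.real) -> (forall x, `|u x| <= 1) ->
  projection_span (mxC_scalar cu (E i i - E j j)).
Proof.
move=> ij ur u1; have [s [cs sr us]] := cosine_complement cu ur u1.
apply: (bloch_diag_span ij cu cs ur) => // x.
by rewrite (CrealP (sr x)) -expr2.
Qed.

(** A single matrix unit is not self-adjoint, so it is recovered by polarization from the
    self-adjoint elements with upper entries [u] and ['i * u]. *)
Lemma real_offdiag_span (i j : 'I_n) (u : X -> K) (cu : continuous u) : i != j ->
  (forall x, u x \is Num.real) -> (forall x, `|u x| <= 1) ->
  projection_span (mxC_scalar cu (E i j)).
Proof.
move=> ij ur u1; have [s [cs sr us]] := cosine_complement cu ur u1.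
have ciu : continuous (fun x => 'i * u x).
  by move=> x; apply: cvgMl_tmp; exact: cu.
pose g w (cw : continuous w) : mxC K X n :=
  mxC_scalar cw (E i j) + mxC_scalar (conj_continuous cw) (E j i).
rewrite (_ : mxC_scalar cu _ = 2^-1 *: (g u cu - 'i *: g _ ciu)); last first.
  apply: mxC_eqP => x; apply/matrixP => a b.
  rewrite /= /mkcts !mxE rmorphM /= conjCi (CrealP (ur x)).
  (* The imaginary unit becomes a variable [I] with [I ^+ 2 = -1], so that [ring] and [field] can
     treat it. *)
  have := sqrCi K; move: 'i => I I2.
  move: (_ && _)%:R (_ && _)%:R => e2 e1.
  rewrite [RHS](_ : _ = 2^-1 * (u x * ((1 - I ^+ 2) * e1 + (1 + I ^+ 2) * e2))).
    by rewrite I2; field.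
  by ring.
apply: linear_spanZ; apply: linear_spanB; last apply: linear_spanZ.
  apply: (bloch_offdiag_span ij cs cu sr) => // x.
  by rewrite (CrealP (ur x)) addrC -expr2.
apply: (bloch_offdiag_span ij cs ciu sr) => // x.
by rewrite rmorphM /= conjCi (CrealP (ur x)) mulNr mulrN mulrACA -!expr2 sqrCi
  mulN1r opprK addrC.
Qed.

(** With [C] a bound for [h] on the compact space, the real and imaginary parts of [h] divided by
    [C] are real contractions. *)
Lemma scalar_span (M : 'M[K]_n) :
  (forall (u : X -> K) (cu : continuous u), (forall x, u x \is Num.real) ->
     (forall x, `|u x| <= 1) -> projection_span (mxC_scalar cu M)) ->
  forall (h : X -> K) (ch : continuous h), projection_span (mxC_scalar ch M).
Proof.
move=> realM h ch; have [C C0 hC] := compact_continuous_bounded X_compact ch.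
have rC : C^-1 \is Num.real by rewrite realV gtr0_real.
have cRe : continuous (fun x => C^-1 * 'Re (h x)).
  by move=> x; apply: cvgMl_tmp; exact: Re_continuous.
have cIm : continuous (fun x => C^-1 * 'Im (h x)).
  by move=> x; apply: cvgMl_tmp; exact: Im_continuous.
rewrite (_ : mxC_scalar ch M = C *: mxC_scalar cRe M
    + (C * 'i) *: mxC_scalar cIm M).
  apply: linear_spanD; apply: linear_spanZ; apply: realM => x.
  - by rewrite realM// Creal_Re.
  - rewrite normrM normfV (gtr0_norm C0) ler_pdivrMl// mulr1.
    by rewrite (le_trans _ (hC x))// leif_normC_Re_Creal.
  - by rewrite realM// Creal_Im.
  - rewrite normrM normfV (gtr0_norm C0) ler_pdivrMl// mulr1.
    rewrite (le_trans _ (hC x))// -normrN -ReMil.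
    by rewrite (le_trans (leif_normC_Re_Creal _))// normrM normCi mul1r.
apply: mxC_eqP => x; apply/matrixP => a b; rewrite /= /mkcts !mxE.
rewrite {1}(Crect (h x)); have := lt0r_neq0 C0; move: ('Re _) ('Im _) => r t.
by move=> C1; field.
Qed.

Lemma mxC_sumE I (r : seq I) (F : I -> mxC K X n) x :
  (\sum_(k <- r) F k) x = \sum_(k <- r) F k x.
Proof. by elim/big_rec2: _ => // k _ f _ <-. Qed.

(** In the expansion of [b] in matrix units, each [E i i] may be replaced by [E i i - E i0 i0]: the
    total change is the trace of [b] times [E i0 i0], which is zero. *)
Lemma trace0_span (b : mxC K X n) : (forall x, \tr (b x) = 0) ->
  projection_span b.
Proof.
move=> tr0; case: (posnP n) => [n0|n0].
  rewrite (_ : b = 0); first exact: linear_span0.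
  by apply: mxC_eqP => x; apply/matrixP => -[i ilt]; exfalso; rewrite n0 in ilt.
pose i0 : 'I_n := Ordinal n0.
pose M i j : 'M[K]_n := if i == j then E i i - E i0 i0 else E i j.
have -> : b = \sum_i \sum_j mxC_scalar (@mxC_entry _ _ _ b i j) (M i j).
  apply: mxC_eqP => x; rewrite mxC_sumE.
  under eq_bigr do rewrite mxC_sumE.
  rewrite {1}(matrix_sum_delta (b x)) [RHS]/=.
  apply/eqP; rewrite -subr_eq0 -sumrB.
  under eq_bigr => i _.
    rewrite -sumrB (bigD1 i)//= /mkcts /M eqxx big1 ?addr0; last first.
      by move=> j ji; rewrite eq_sym (negPf ji) subrr.
    rewrite -scalerBr opprB addrC subrK.
    over.
  by rewrite /= -scaler_suml [X in X *: _]tr0 scale0r.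
apply: linear_span_sum => i _; apply: linear_span_sum => j _.
apply: scalar_span => u cu ur u1.
rewrite /M; case: (eqVneq i j) => [_|ij]; last exact: real_offdiag_span.
case: (eqVneq i i0) => [->|ii0]; last exact: real_diag_span.
rewrite (_ : mxC_scalar _ _ = 0); first exact: linear_span0.
by apply: mxC_eqP => x; rewrite /= /mkcts subrr scaler0.
Qed.

End TraceZero.

(** * Spans of projections in direct sums *)

Section DirectSumSpan.
Variables (K : numClosedFieldType) (k : nat) (D : 'I_k -> starAlgType K).

Lemma dsumDE (f g : dsum D) t : (f + g) t = f t + g t. Proof. by []. Qed.

Lemma dsumZE c (f : dsum D) t : (c *: f) t = c *: f t. Proof. by []. Qed.

Lemma dsumME (f g : dsum D) t : smul f g t = smul (f t) (g t).
Proof. by []. Qed.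

Lemma dsumSE (f : dsum D) t : star f t = star (f t). Proof. by []. Qed.

Lemma dsum_inj_eq s (x : D s) : dsum_inj x s = x.
Proof. exact: dfwithin. Qed.

Lemma dsum_inj_neq s t (x : D s) : s != t -> dsum_inj x t = 0.
Proof. exact: dfwithout. Qed.

Lemma dsum_inj_star_hom s : star_hom (@dsum_inj K k D s).
Proof.
split=> [c x y|x y|x]; apply: dsum_eqP => t; case: (eqVneq s t) => [<-|st];
  rewrite ?(dsumDE, dsumZE, dsumME, dsumSE) ?dsum_inj_eq// !dsum_inj_neq//.
- by rewrite scaler0 addr0.
(* Writing [0] as [0 *: 0] lets the homogeneity of [smul] show that a product of zeros vanishes. *)
- by rewrite -(scale0r (0 : D t)) smulZl !scale0r.
- by rewrite -(scale0r (0 : D t)) starZ rmorph0 !scale0r.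
Qed.

Lemma dsum_sumE (f : dsum D) : f = \sum_s dsum_inj (f s).
Proof.
apply: dsum_eqP => t.
have -> : (\sum_s dsum_inj (f s) : dsum D) t = \sum_s dsum_inj (f s) t.
  by elim/big_rec2: _ => // s _ g _ <-.
rewrite (bigD1 t)//= dsum_inj_eq big1 ?addr0// => s st.
by rewrite dsum_inj_neq.
Qed.

Lemma dsum_span (f : dsum D) : (forall t, projection_span (f t)) ->
  projection_span f.
Proof.
move=> fs; rewrite (dsum_sumE f); apply: linear_span_sum => s _.
exact/star_hom_projection_span/fs/dsum_inj_star_hom.
Qed.

End DirectSumSpan.

(** * Traces and eigenvalue variation *)

Section TraceEigenvalues.
Variable R : realType.

Lemma eigenvaluesE n (M : 'M[R[i]]_n) :
  char_poly M = \prod_(z <- eigenvalues M) ('X - z%:P).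
Proof.
rewrite /eigenvalues; case: closed_field_poly_normal => r /= {1}->.
by rewrite (monicP (char_poly_monic M)) scale1r.
Qed.

Lemma size_eigenvalues n (M : 'M[R[i]]_n) : size (eigenvalues M) = n.
Proof.
by have := size_char_poly M; rewrite eigenvaluesE size_prod_XsubC => -[].
Qed.

(** Both sides are minus the coefficient of degree [n.-1] of the characteristic polynomial; size [0]
    is treated apart. *)
Lemma trace_eigenvalues n (M : 'M[R[i]]_n) : \tr M = \sum_(z <- eigenvalues M) z.
Proof.
have [n0|n0] := posnP n.
  have /size0nil-> : size (eigenvalues M) = 0%N by rewrite size_eigenvalues.
  by rewrite big_nil /mxtrace big1// => -[i ilt]; exfalso; rewrite n0 in ilt.
apply: oppr_inj; rewrite -char_poly_trace// eigenvaluesE.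
rewrite -{2}(size_eigenvalues M) coefPn_prod_XsubC// size_eigenvalues.
by rewrite -lt0n.
Qed.

(** Sorting only permutes the summands, and since the list has length [n], the default of [nth]
    never occurs. *)
Lemma Re_trace_lowest n (M : 'M[R[i]]_n) :
  complex.Re (\tr M) = \sum_(m < n) lowest_eigenvalue M m.
Proof.
rewrite trace_eigenvalues raddf_sum /= /lowest_eigenvalue.
set s := sort _ _.
have ss : size s = n by rewrite size_sort size_map size_eigenvalues.
rewrite -(big_mkord xpredT (nth 0 s)) -[X in \sum_(0 <= _ < X) _]ss.
rewrite -(big_nth 0 xpredT id).
rewrite -(big_map (@complex.Re R) xpredT id); apply: perm_big.
by rewrite perm_sym perm_sort.
Qed.

(** Eigenvalues of equal rank at [x] and [y] differ by at most [eps], and there are [bsize t]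
    ranks. *)
Lemma EV_trace (B : blocks) (a : block_alg R B) (eps : R) t x y :
  (EV a < eps%:E)%E ->
  `|complex.Re (\tr (a t x)) - complex.Re (\tr (a t y))| <= (bsize t)%:R * eps.
Proof.
move=> /ltW EVa; rewrite !Re_trace_lowest -sumrB.
rewrite (le_trans (ler_norm_sum _ _ _))//.
rewrite [leRHS](_ : _ = \sum_(m < bsize t) eps); last first.
  by rewrite sumr_const card_ord mulr_natl.
apply: ler_sum => m _; rewrite -lee_fin (le_trans _ EVa)//.
rewrite /EV; apply: (bigmax_sup t) => //; apply: (bigmax_sup m) => //.
by apply: ereal_sup_ubound; exists (x, y).
Qed.

End TraceEigenvalues.

(** * Central elements and approximation by the normalized trace *)

Section CentralScalars.
Variables (K : numClosedFieldType) (k : nat).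
Variables (X : 'I_k -> topologicalType) (n : 'I_k -> nat).
Local Notation D := (dsum (fun t => mxC K (X t) (n t))).

Lemma mxtrace_continuous t (f : mxC K (X t) (n t)) :
  continuous (fun x => \tr (f x)).
Proof.
rewrite /mxtrace; apply: continuous_big => [|i _]; first exact: add_continuous.
exact: mxC_entry.
Qed.

Lemma self_adjoint_trace_real (a : D) t x :
  self_adjoint a -> \tr (a t x) \is Num.real.
Proof.
move=> sa; apply/CrealP; rewrite rmorph_sum; apply: eq_bigr => i _ /=.
by rewrite -[in RHS]sa /= /mkcts !mxE.
Qed.

Definition block_scalar (h : forall t, X t -> K)
    (ch : forall t, continuous (h t)) : D :=
  fun t => mxC_scalar (ch t) 1%:M.

(** [norm_le1_of_sumsq] is applied with [e] the image of the unit of [D], which is a projection even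
    if [A] has no unit. *)
Lemma norm_block_scalar_le1 (A : cstarAlgType K) (mu : D -> A)
    (h : forall t, X t -> K) (ch : forall t, continuous (h t)) :
  star_hom mu -> (forall t x, h t x \is Num.real) ->
  (forall t x, `|h t x| <= 1) -> `|mu (block_scalar ch)| <= 1.
Proof.
move=> muh hr h1.
have sE t := cosine_complement (ch t) (hr t) (h1 t).
pose s t := sval (cid (sE t)).
have cs t : continuous (s t) by rewrite /s; case: cid => ? [].
have sr t x : s t x \is Num.real by rewrite /s; case: cid => ? [].
have hs t x : h t x ^+ 2 + s t x ^+ 2 = 1 by rewrite /s; case: cid => ? [].
have c1 t : continuous (fun _ : X t => 1 : K) by move=> x; exact: cvg_cst.
have sa (g : forall t, X t -> K) (cg : forall t, continuous (g t)) :
    (forall t x, g t x \is Num.real) ->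
    star (block_scalar cg) = block_scalar cg.
  move=> gr; apply: dsum_eqP => t; apply: mxC_eqP => x; rewrite /= /mkcts.
  apply/matrixP => a b; rewrite !mxE rmorphM rmorph_nat /= (CrealP (gr t x)).
  by rewrite eq_sym.
have mulE (g1 g2 : forall t, X t -> K) (cg1 : forall t, continuous (g1 t))
    (cg2 : forall t, continuous (g2 t)) t x :
    smul (block_scalar cg1) (block_scalar cg2) t x = (g1 t x * g2 t x)%:M.
  by rewrite /= /mkcts /= /mkcts -scalemxAl -scalemxAr mulmx1 scalerA scalemx1.
apply: (@norm_le1_of_sumsq _ _ _ (mu (block_scalar cs)) (mu (block_scalar c1))).
- apply: star_hom_projection => //; split.
    by apply: sa => t x; exact: real1.
  apply: dsum_eqP => t; apply: mxC_eqP => x.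
  by rewrite mulE mulr1 /= /mkcts scale1r.
- by rewrite -(star_homS muh) sa.
- by rewrite -(star_homS muh) sa.
- rewrite -!(star_homM muh); congr (mu _).
  by apply: dsum_eqP => t; apply: mxC_eqP => x; rewrite !mulE mulrC.
- rewrite -!(star_homM muh) -(star_homD muh); congr (mu _).
  apply: dsum_eqP => t; apply: mxC_eqP => x.
  rewrite -[LHS]/(smul (block_scalar ch) (block_scalar ch) t x
     + smul (block_scalar cs) (block_scalar cs) t x) !mulE.
  by rewrite -raddfD /= -!expr2 hs /= /mkcts scale1r.
Qed.

Lemma norm_block_scalar_le (A : cstarAlgType K) (mu : D -> A)
    (h : forall t, X t -> K) (ch : forall t, continuous (h t))
    (e : K) : 0 < e ->
  star_hom mu -> (forall t x, h t x \is Num.real) ->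
  (forall t x, `|h t x| <= e) -> `|mu (block_scalar ch)| <= e.
Proof.
move=> e0 muh hr he.
have cg t : continuous (fun x => e^-1 * h t x).
  by move=> x; apply: cvgMl_tmp; exact: ch.
have -> : block_scalar ch = e *: block_scalar cg.
  apply: dsum_eqP => t; apply: mxC_eqP => x; rewrite /= /mkcts.
  by rewrite scalerA mulrA divff ?mul1r ?lt0r_neq0.
rewrite (star_homZ muh) normrZ gtr0_norm// -[leRHS]mulr1 ler_pM2l//.
apply: norm_block_scalar_le1 => // t x.
  by rewrite realM// realV gtr0_real.
by rewrite normrM normfV (gtr0_norm e0) ler_pdivrMl// mulr1.
Qed.

Hypothesis n_gt0 : forall t, (0 < n t)%N.
Hypothesis X_compact : forall t, compact [set: X t].

(** With [tau] the normalized trace and [c t] a nearby constant on each summand, [l] is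
    [a - tau + c]: a part of trace zero plus multiples of the block units. The error [tau - c] is
    central, real and at most [e]. *)
Lemma trace_osc_approx (a : D) (e : K) : 0 < e -> self_adjoint a ->
  (forall t x y, `|\tr (a t x) - \tr (a t y)| <= (n t)%:R * e) ->
  exists2 l, projection_span l & forall (A : cstarAlgType K) (mu : D -> A),
    star_hom mu -> `|mu a - mu l| <= e.
Proof.
move=> e0 sa tr_osc.
have n0 t : 0 < (n t)%:R :> K by rewrite ltr0n.
pose tau t x := (n t)%:R^-1 * \tr (a t x).
have taur t x : tau t x \is Num.real.
  by apply: realM; [rewrite realV gtr0_real|exact: self_adjoint_trace_real].
have tau_osc t x y : `|tau t x - tau t y| <= e.
  by rewrite -mulrBr normrM normfV (gtr0_norm (n0 t)) ler_pdivrMl.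
(* The constant is a value of [tau t]; an empty [X t], which the hypotheses allow, gets [0]. *)
have /choice[c hc] : forall t, exists c : K, forall x,
    tau t x - c \is Num.real /\ `|tau t x - c| <= e.
  move=> t; have [[x0]|noX] := pselect (inhabited (X t)).
    by exists (tau t x0) => x; rewrite realB.
  by exists 0 => x; exfalso; apply: noX.
have ch t : continuous (fun x => tau t x - c t).
  move=> x; apply: cvgB; last exact: cvg_cst.
  by apply: cvgMl_tmp; exact: mxtrace_continuous.
exists (a - block_scalar ch); last first.
  move=> A mu muh; rewrite -[- block_scalar ch]scaleN1r (star_homD muh).
  rewrite (star_homZ muh) scaleN1r opprB addrC subrK.
  by apply: norm_block_scalar_le => // t x; case: (hc t x).
have c1 t : continuous (fun _ : X t => c t) by move=> x; exact: cvg_cst.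
pose one t : mxC K (X t) (n t) := mkcts (@mxC_cst_cts K (X t) (n t) 1%:M).
apply: dsum_span => t; rewrite -[(a - _) t](subrK (c t *: one t)).
apply: linear_spanD; last first.
  apply/linear_spanZ/linear_span_sub; split; apply: mxC_eqP => x /=.
    by rewrite /mkcts /= trmx1 map_mx1.
  exact: mulmx1.
apply: trace0_span => // x.
rewrite [X in \tr X](_ : _ = a t x - (tau t x)%:M); last first.
  apply/matrixP => i j; rewrite /= /mkcts /= !mxE.
  by case: (i == j) => /=; ring.
rewrite mxtraceD raddfN /= mxtrace_scalar -mulr_natl mulrA.
by rewrite divff ?mul1r ?subrr ?lt0r_neq0.
Qed.

End CentralScalars.

(** The traces of a self-adjoint element are real, so the bound of [EV_trace] on their real parts is
    the oscillation bound that [trace_osc_approx] requires. *)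
Lemma EV_approx (R : realType) (B : blocks) (a : block_alg R B) (eps : R) :
  0 < eps -> self_adjoint a -> (EV a < eps%:E)%E ->
  exists2 l, projection_span l & forall (A : cstarAlgType R[i])
    (mu : block_alg R B -> A), star_hom mu -> `|mu a - mu l| <= eps%:C%C.
Proof.
move=> eps0 sa EVa.
apply: (trace_osc_approx (@bsize_gt0 B) (@bspace_compact B)) => //.
  by rewrite ltcR.
move=> t x y.
have trE (z : bspace t) := RRe_real
  (@self_adjoint_trace_real R[i] _ (@bspace B) (@bsize B) a t z sa).
rewrite -trE -(trE y) -rmorphB.
have := EV_trace x y EVa; rewrite -lecR rmorphM rmorph_nat.
by apply: le_trans; rewrite normc_def /= expr0n addr0 sqrtr_sqr.
Qed.

Theorem theorem2p3 (R : realType) (B : nat -> blocks)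
    (phi : forall i : nat, block_alg R (B i) -> block_alg R (B i.+1))
    (A : cstarAlgType R[i])
    (mu : forall i : nat, block_alg R (B i) -> A) :
  (forall i : nat, star_hom (phi i)) ->
  (forall i : nat, diagonal_hom (phi i)) ->
  is_inductive_limit phi mu ->
  small_eigenvalue_variation phi ->
  LP_property A.
Proof.
move=> phi_hom _ lim sev; have [coc _] := lim; have [mu_hom _] := coc.
have conn_hom i d : star_hom (@connecting _ _ phi i d).
  by elim: d => //= d IHd; exact: star_hom_comp (phi_hom _) IHd.
have sa_approx i (a : block_alg R (B i)) (e : R[i]) : 0 < e -> self_adjoint a ->
    exists2 l, projection_span l & `|mu i a - l| <= e.
  (* A positive element of [R[i]] is real, so its real part serves as the tolerance for [EV]. *)
  move=> e0 sa; have eE := RRe_real (gtr0_real e0).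
  have eps0 : 0 < complex.Re e by rewrite -ltcR eE.
  have [d EVd] := sev i a sa _ eps0.
  have sad := star_hom_self_adjoint (conn_hom i d) sa.
  have [l ls hl] := EV_approx eps0 sad EVd.
  exists (mu _ l); first exact: star_hom_projection_span.
  (* Moving [a] to the stage where its variation is small does not change its image in [A]. *)
  by rewrite -(cocone_connecting coc d) -eE; exact: hl.
apply: dense_normP => x e e0.
have e20 : 0 < e / 2 by rewrite divr_gt0.
(* Half of [e] goes to approximating [x] by some [mu i a], a quarter to each of the self-adjoint
   parts [a1] and [a2] of [a]. *)
have e40 : 0 < e / 2 / 2 by rewrite divr_gt0.
have /closure_normP/(_ _ e20)[_ [i [a ->]] xa] : closure (limit_range mu) x.
  exact: inductive_limit_dense lim _.
pose a1 := 2^-1 *: (a + star a); pose a2 := - (2^-1 * 'i) *: (a - star a).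
have sa1 : self_adjoint a1.
  by rewrite /self_adjoint starZ starD starK addrC fmorphV rmorph_nat.
have sa2 : self_adjoint a2.
  rewrite /self_adjoint starZ rmorphN rmorphM fmorphV rmorph_nat /= conjCi.
  rewrite -[- star a]scaleN1r starD starZ starK rmorphN rmorph1 mulrN opprK.
  by rewrite !scaleN1r /a2 scaleNr -scalerN opprB.
have aE : a = a1 + 'i *: a2.
  rewrite /a1 /a2 scalerA mulrN mulrCA -expr2 sqrCi mulrN1 opprK -scalerDr.
  by rewrite addrACA addrN addr0 -mulr2n -[a *+ 2]scaler_nat scalerA mulVf
    ?scale1r.
have [l1 s1 h1] := sa_approx i a1 _ e40 sa1.
have [l2 s2 h2] := sa_approx i a2 _ e40 sa2.
exists (l1 + 'i *: l2); first by apply/linear_spanD/linear_spanZ.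
rewrite -(subrK (mu i a) x) -addrA (splitr e) (le_lt_trans (ler_normD _ _))//.
rewrite ltr_leD// {1}aE (star_homD (mu_hom i)) (star_homZ (mu_hom i) 'i).
rewrite opprD addrACA -scalerBr [leRHS]splitr (le_trans (ler_normD _ _))//.
by rewrite lerD// normrZ normCi mul1r.
Qed.
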